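(* Consider the quadratic-bilinear (QB) system given by the real matrices $A,N_1,\dots,N_m\in\mathbb{R}^{n\times n}$, $H\in\mathbb{R}^{n\times n^2}$ (symmetric as a Hessian), $B\in\mathbb{R}^{n\times m}$, $C\in\mathbb{R}^{p\times n}$, with $A$ stable. Let $P_{\mathcal T}$ and $Q_{\mathcal T}$ be the truncated reachability and observability Gramians of the system. Then $P_{\mathcal T}$ and $Q_{\mathcal T}$ satisfy the Lyapunov equations $$AP_{\mathcal T}+P_{\mathcal T}A^T+H(\hat P_1\otimes\hat P_1)H^T+\sum_{k=1}^mN_k\hat P_1N_k^T+BB^T=0,$$ $$A^TQ_{\mathcal T}+Q_{\mathcal T}A+\mathcal{H}^{(2)}(\hat P_1\otimes\hat Q_1)(\mathcal{H}^{(2)})^T+\sum_{k=1}^mN_k^T\hat Q_1N_k+C^TC=0,$$ respectively, where $\hat P_1$ and $\hat Q_1$ are the solutions of $$A\hat P_1+\hat P_1A^T+BB^T=0,\qquad A^T\hat Q_1+\hat Q_1A+C^TC=0 .$$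
   Context: The QB system is $\dot x(t)=Ax(t)+H(x(t)\otimes x(t))+\sum_{k=1}^m N_kx(t)u_k(t)+Bu(t)$, $y(t)=Cx(t)$, $x(0)=0$; $\otimes$ is the Kronecker product. A matrix is stable if all its eigenvalues have negative real part. $H$ is symmetric, i.e. $H(u\otimes v)=H(v\otimes u)$ for all $u,v\in\mathbb{R}^n$. Matricization: let $\mathcal{H}=(h_{ijk})\in\mathbb{R}^{n\times n\times n}$ be the tensor whose mode-1 matricization is $H$, i.e. $H_{i,(k-1)n+j}=h_{ijk}$. Its mode-2 matricization is $\mathcal{H}^{(2)}\in\mathbb{R}^{n\times n^2}$ with $\mathcal{H}^{(2)}_{j,(k-1)n+i}=h_{ijk}$; equivalently $\mathcal{H}^{(2)}(x\otimes z)=(x^T\otimes I_n)H^Tz$ for all $x,z\in\mathbb{R}^n$. Truncated Gramians: define (brackets with commas denote horizontal concatenation) $\tilde P_1(t_1)=e^{At_1}B$, $\tilde P_2(t_1,t_2)=e^{At_2}[N_1,\dots,N_m](I_m\otimes\tilde P_1(t_1))$, $\tilde P_3(t_1,t_2,t_3)=e^{At_3}H(\tilde P_1(t_1)\otimes\tilde P_1(t_2))$, $\tilde Q_1(t_1)=e^{A^Tt_1}C^T$, $\tilde Q_2(t_1,t_2)=e^{A^Tt_2}[N_1^T,\dots,N_m^T](I_m\otimes\tilde Q_1(t_1))$, $\tilde Q_3(t_1,t_2,t_3)=e^{A^Tt_3}\mathcal{H}^{(2)}(\tilde P_1(t_1)\otimes\tilde Q_1(t_2))$. Then $P_{\mathcal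 T}=\sum_{i=1}^3\hat P_i$ with $\hat P_i=\int_0^\infty\cdots\int_0^\infty\tilde P_i\tilde P_i^T\,dt_1\cdots dt_i$, and $Q_{\mathcal T}=\sum_{i=1}^3\hat Q_i$ with $\hat Q_i=\int_0^\infty\cdots\int_0^\infty\tilde Q_i\tilde Q_i^T\,dt_1\cdots dt_i$ ($i$-fold integrals). *)

(* Defs.v *)
From HB Require Import structures.
From mathcomp Require Import all_boot all_order all_algebra.
From mathcomp Require Import all_classical all_reals all_analysis.
From mathcomp Require Import complex mxtens.

Set Implicit Arguments.
Unset Strict Implicit.
Unset Printing Implicit Defensive.

Import Order.TTheory GRing.Theory Num.Theory numFieldNormedType.Exports.

Local Open Scope classical_set_scope.
Local Open Scope ring_scope.

Definition mxexp (R : realType) (n : nat) (A : 'M[R]_n) : 'M[R]_n :=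
  limn (series (fun k : nat => (k`!%:R)^-1 *: A ^+ k)).

(* The eigenvalues of the real matrix A are those of A seen as a complex
   matrix. *)
Definition stable (R : realType) (n : nat) (A : 'M[R]_n) : Prop :=
  forall z : R[i],
    eigenvalue (map_mx (real_complex R) A) z -> complex.Re z < 0.

(* The pair (k, j) (k the slow index, both starting from 0) is encoded by
   [mxtens_index (k, j)], which is k * n + j; this is the indexing used by the
   Kronecker product [*t]. *)

Definition hessian_symmetric (R : realType) (n : nat) (H : 'M[R]_(n, n * n)) :
    Prop :=
  forall u v : 'cV[R]_n, H *m (u *t v) = H *m (v *t u).

Definition mode2 (R : realType) (n : nat) (H : 'M[R]_(n, n * n)) :
    'M[R]_(n, n * n) :=
  \matrix_(j < n, l < n * n)
    H (mxtens_unindex l).2 (mxtens_index ((mxtens_unindex l).1, j)).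

(* Horizontal concatenation [N_1, ..., N_m]; [\mxrow_k N k] has width
   [\sum_(k < m) n], which is not convertible to the width [m * n] needed to
   multiply by [1%:M *t _]. *)
Definition hcat (R : realType) (n m : nat) (N : 'I_m -> 'M[R]_n) :
    'M[R]_(n, m * n) :=
  \matrix_(i < n, l < m * n) N (mxtens_unindex l).1 i (mxtens_unindex l).2.

(* Integrals over [0, +oo[ are entrywise Lebesgue integrals, and i-fold
   integrals are iterated, with dt_1 innermost.  As [Rintegral] is total, the
   predicates [mxcvg1], [mxcvg2], [mxcvg3] say that all the integrals involved
   in [mxint1], [mxint2], [mxint3] converge (absolutely). *)

Definition mxint1 (R : realType) (p q : nat) (F : R -> 'M[R]_(p, q)) :
    'M[R]_(p, q) :=
  \matrix_(i < p, j < q) \int[@lebesgue_measure R]_(t in `[0, +oo[) F t i j.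

Definition mxint2 (R : realType) (p q : nat) (F : R -> R -> 'M[R]_(p, q)) :
    'M[R]_(p, q) :=
  mxint1 (fun t2 => mxint1 (fun t1 => F t1 t2)).

Definition mxint3 (R : realType) (p q : nat)
    (F : R -> R -> R -> 'M[R]_(p, q)) : 'M[R]_(p, q) :=
  mxint1 (fun t3 => mxint2 (fun t1 t2 => F t1 t2 t3)).

Definition mxcvg1 (R : realType) (p q : nat) (F : R -> 'M[R]_(p, q)) : Prop :=
  forall (i : 'I_p) (j : 'I_q),
    (@lebesgue_measure R).-integrable `[0, +oo[ (fun t => (F t i j)%:E).

Definition mxcvg2 (R : realType) (p q : nat) (F : R -> R -> 'M[R]_(p, q)) :
    Prop :=
  (forall t2, 0 <= t2 -> mxcvg1 (fun t1 => F t1 t2)) /\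
  mxcvg1 (fun t2 => mxint1 (fun t1 => F t1 t2)).

Definition mxcvg3 (R : realType) (p q : nat)
    (F : R -> R -> R -> 'M[R]_(p, q)) : Prop :=
  (forall t3, 0 <= t3 -> mxcvg2 (fun t1 t2 => F t1 t2 t3)) /\
  mxcvg1 (fun t3 => mxint2 (fun t1 t2 => F t1 t2 t3)).

Definition mulT (R : realType) (p q : nat) (X : 'M[R]_(p, q)) : 'M[R]_p :=
  X *m X^T.

Definition Ptilde1 (R : realType) (n m : nat) (A : 'M[R]_n) (B : 'M[R]_(n, m))
    (t1 : R) : 'M[R]_(n, m) :=
  mxexp (t1 *: A) *m B.

Definition Ptilde2 (R : realType) (n m : nat) (A : 'M[R]_n)
    (N : 'I_m -> 'M[R]_n) (B : 'M[R]_(n, m)) (t1 t2 : R) :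
    'M[R]_(n, m * m) :=
  mxexp (t2 *: A) *m hcat N *m ((1%:M : 'M[R]_m) *t Ptilde1 A B t1).

Definition Ptilde3 (R : realType) (n m : nat) (A : 'M[R]_n)
    (H : 'M[R]_(n, n * n)) (B : 'M[R]_(n, m)) (t1 t2 t3 : R) :
    'M[R]_(n, m * m) :=
  mxexp (t3 *: A) *m H *m (Ptilde1 A B t1 *t Ptilde1 A B t2).

Definition Qtilde1 (R : realType) (n p : nat) (A : 'M[R]_n) (C : 'M[R]_(p, n))
    (t1 : R) : 'M[R]_(n, p) :=
  mxexp (t1 *: A^T) *m C^T.

Definition Qtilde2 (R : realType) (n m p : nat) (A : 'M[R]_n)
    (N : 'I_m -> 'M[R]_n) (C : 'M[R]_(p, n)) (t1 t2 : R) :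
    'M[R]_(n, m * p) :=
  mxexp (t2 *: A^T) *m hcat (fun k => (N k)^T)
    *m ((1%:M : 'M[R]_m) *t Qtilde1 A C t1).

Definition Qtilde3 (R : realType) (n m p : nat) (A : 'M[R]_n)
    (H : 'M[R]_(n, n * n)) (B : 'M[R]_(n, m)) (C : 'M[R]_(p, n))
    (t1 t2 t3 : R) : 'M[R]_(n, m * p) :=
  mxexp (t3 *: A^T) *m mode2 H *m (Ptilde1 A B t1 *t Qtilde1 A C t2).

Definition Phat1 (R : realType) (n m : nat) (A : 'M[R]_n)
    (B : 'M[R]_(n, m)) : 'M[R]_n :=
  mxint1 (fun t1 => mulT (Ptilde1 A B t1)).

Definition Phat2 (R : realType) (n m : nat) (A : 'M[R]_n)
    (N : 'I_m -> 'M[R]_n) (B : 'M[R]_(n, m)) : 'M[R]_n :=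
  mxint2 (fun t1 t2 => mulT (Ptilde2 A N B t1 t2)).

Definition Phat3 (R : realType) (n m : nat) (A : 'M[R]_n)
    (H : 'M[R]_(n, n * n)) (B : 'M[R]_(n, m)) : 'M[R]_n :=
  mxint3 (fun t1 t2 t3 => mulT (Ptilde3 A H B t1 t2 t3)).

Definition Qhat1 (R : realType) (n p : nat) (A : 'M[R]_n)
    (C : 'M[R]_(p, n)) : 'M[R]_n :=
  mxint1 (fun t1 => mulT (Qtilde1 A C t1)).

Definition Qhat2 (R : realType) (n m p : nat) (A : 'M[R]_n)
    (N : 'I_m -> 'M[R]_n) (C : 'M[R]_(p, n)) : 'M[R]_n :=
  mxint2 (fun t1 t2 => mulT (Qtilde2 A N C t1 t2)).

Definition Qhat3 (R : realType) (n m p : nat) (A : 'M[R]_n)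
    (H : 'M[R]_(n, n * n)) (B : 'M[R]_(n, m)) (C : 'M[R]_(p, n)) :
    'M[R]_n :=
  mxint3 (fun t1 t2 t3 => mulT (Qtilde3 A H B C t1 t2 t3)).

Definition truncated_reachability_gramian (R : realType) (n m : nat)
    (A : 'M[R]_n) (N : 'I_m -> 'M[R]_n) (H : 'M[R]_(n, n * n))
    (B : 'M[R]_(n, m)) : 'M[R]_n :=
  Phat1 A B + Phat2 A N B + Phat3 A H B.

Definition truncated_observability_gramian (R : realType) (n m p : nat)
    (A : 'M[R]_n) (N : 'I_m -> 'M[R]_n) (H : 'M[R]_(n, n * n))
    (B : 'M[R]_(n, m)) (C : 'M[R]_(p, n)) : 'M[R]_n :=
  Qhat1 A C + Qhat2 A N C + Qhat3 A H B C.

Definition truncated_reachability_gramian_exists (R : realType) (n m : nat)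
    (A : 'M[R]_n) (N : 'I_m -> 'M[R]_n) (H : 'M[R]_(n, n * n))
    (B : 'M[R]_(n, m)) : Prop :=
  [/\ mxcvg1 (fun t1 => mulT (Ptilde1 A B t1)),
      mxcvg2 (fun t1 t2 => mulT (Ptilde2 A N B t1 t2))
    & mxcvg3 (fun t1 t2 t3 => mulT (Ptilde3 A H B t1 t2 t3))].

Definition truncated_observability_gramian_exists (R : realType) (n m p : nat)
    (A : 'M[R]_n) (N : 'I_m -> 'M[R]_n) (H : 'M[R]_(n, n * n))
    (B : 'M[R]_(n, m)) (C : 'M[R]_(p, n)) : Prop :=
  [/\ mxcvg1 (fun t1 => mulT (Qtilde1 A C t1)),
      mxcvg2 (fun t1 t2 => mulT (Qtilde2 A N C t1 t2))
    & mxcvg3 (fun t1 t2 t3 => mulT (Qtilde3 A H B C t1 t2 t3))].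

(* Main.v *)
(* By Cayley-Hamilton, stability makes e^(tA) decay exponentially: peeling off
   the roots of the characteristic polynomial one at a time leaves scalar
   equations z' = r z + g with Re r < 0 and g decaying.  So
   L(S) = int_0^oo e^(tA) S e^(tA)^T dt converges, and integrating the
   derivative of the integrand gives L(A S + S A^T) = - S, hence uniqueness of
   solutions of A X + X A^T = - S.  As e^(tA) commutes with A, L(S) is one.
   Integrals commute with linear maps, so each truncated Gramian is a sum of
   three terms L(S), with S the last three terms of its equation. *)
Require Import Defs.
From HB Require Import structures.
From mathcomp Require Import all_boot all_order all_algebra.
From mathcomp Require Import all_classical all_reals all_analysis.
From mathcomp Require Import complex mxtens ring lra measurable_realfun.

Set Implicit Arguments.
Unset Strict Implicit.
Unset Printing Implicit Defensive.

Import Order.TTheory GRing.Theory Num.Theory numFieldNormedType.Exports.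

Local Open Scope ring_scope.

(** * Entries of the matrix exponential as power series *)

Section MatrixExponential.
Local Open Scope classical_set_scope.
Variables (R : realType) (n : nat) (A : 'M[R]_n).

Lemma mx_coord_cvg (p q : nat) (u : nat -> 'M[R]_(p, q)) (M : 'M[R]_(p, q)) :
  (forall i j, (fun k => u k i j) @ \oo --> M i j) -> u @ \oo --> M.
Proof.
move=> uM; apply/cvg_mx_entourageP => E entE.
apply: filter_forall => i; apply: filter_forall => j.
have /cvg_app_entourageP/(_ E entE) := uM i j.
by apply: filterS => k Ek; exact/mem_set.
Qed.

(** The sum of the absolute values of all entries is a crude submultiplicative bound. It suffices to
    dominate the entries of the matrix exponential series by a scalar exponential series. *)
Lemma mxpower_le i j k :
  `|(A ^+ k) i j| <= (\sum_i \sum_j `|A i j|) ^+ k.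
Proof.
elim: k i => [|k IH] i.
  by rewrite !expr0 mxE; case: (_ == _); rewrite ?normr1 ?normr0.
rewrite exprS -[A * _]/(A *m _) mxE (le_trans (ler_norm_sum _ _ _))//.
(* Only row [i] of the double sum is kept; the other rows contribute a nonnegative amount. *)
rewrite exprS [X in _ <= X * _](bigD1 i)//= mulrDl ler_wpDr//.
  by rewrite mulr_ge0 ?exprn_ge0 ?sumr_ge0// => *; rewrite sumr_ge0.
rewrite mulr_suml ler_sum// => l _.
by rewrite normrM ler_wpM2l.
Qed.

Lemma is_cvg_mxexp_coef i j (x : R) :
  cvgn (pseries (fun k => (k`!%:R)^-1 * (A ^+ k) i j) x).
Proof.
apply: normed_cvg.
apply: (@series_le_cvg _ _ (exp_coeff ((\sum_i \sum_j `|A i j|) * `|x|))).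
- by move=> k /=.
- move=> k; rewrite exp_coeff_ge0// mulr_ge0// sumr_ge0// => *.
  by rewrite sumr_ge0.
- move=> k; rewrite exp_coeffE/= !normrM normfV normr_nat exprMn normrX.
  by rewrite -mulrA ler_wpM2l ?invr_ge0// ler_wpM2r ?exprn_ge0 ?mxpower_le.
- exact: is_cvg_series_exp_coeff.
Qed.

Lemma mxpowerZ (x : R) k : (x *: A) ^+ k = x ^+ k *: A ^+ k.
Proof.
elim: k => [|k IH]; first by rewrite !expr0 scale1r.
by rewrite !exprS IH -[LHS]/(x *: A *m _) -scalemxAl -scalemxAr scalerA.
Qed.

(** Seen entrywise, the exponential becomes a family of scalar power series in [x], which can be
    differentiated term by term. *)
Lemma mxexp_pseries (x : R) i j :
  mxexp (x *: A) i j = limn (pseries (fun k => (k`!%:R)^-1 * (A ^+ k) i j) x).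
Proof.
pose M := \matrix_(i, j)
  limn (pseries (fun k => (k`!%:R)^-1 * (A ^+ k) i j) x).
suff cvM : series (fun k : nat => (k`!%:R)^-1 *: (x *: A) ^+ k) @ \oo --> M.
  by rewrite /mxexp (cvg_lim _ cvM) ?mxE//; exact: norm_hausdorff.
apply: mx_coord_cvg => a b; rewrite mxE.
set u := pseries _ _.
suff -> : (fun k => series (fun k => (k`!%:R)^-1 *: (x *: A) ^+ k) k a b) = u.
  exact: is_cvg_mxexp_coef.
apply/funext => k; rewrite /u /pseries /series /= summxE; apply: eq_bigr => l _.
by rewrite mxE mxpowerZ mxE mulrCA mulrC.
Qed.

Lemma cvg_mxexp (x : R) i j :
  pseries (fun k => (k`!%:R)^-1 * (A ^+ k) i j) x @ \oo --> mxexp (x *: A) i j.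
Proof. by rewrite mxexp_pseries; exact: is_cvg_mxexp_coef. Qed.

(** The shift [l] makes this family of series closed under formal differentiation: the factor
    [k + 1] turns [1/(k+1)!] into [1/k!], and one more power of [A] appears. *)
Let coef_diffs l i j :
  pseries_diffs (fun k => (k`!%:R)^-1 * (A ^+ (l + k)) i j) =
  (fun k => (k`!%:R)^-1 * (A ^+ (l.+1 + k)) i j).
Proof.
apply/funext => k; rewrite /pseries_diffs addnS factS natrM invfM.
by rewrite -mulrA mulVKf// pnatr_eq0.
Qed.

Let cvg_mulmxl l (x : R) i j :
  pseries (fun k => (k`!%:R)^-1 * (A ^+ (l + k)) i j) x @ \oo -->
  (A ^+ l *m mxexp (x *: A)) i j.
Proof.
rewrite [X in X @ _ --> _](_ : _ = fun N => \sum_s (A ^+ l) i s *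
    pseries (fun k => (k`!%:R)^-1 * (A ^+ k) s j) x N).
  rewrite mxE; apply: cvg_big => [|s _]; first exact: add_continuous.
  by apply: cvgM; [exact: cvg_cst|exact: cvg_mxexp].
apply/funext => N; rewrite /pseries /series /=.
under [RHS]eq_bigr do rewrite mulr_sumr.
rewrite exchange_big; apply: eq_bigr => k _ /=.
rewrite exprD -[A ^+ l * _]/(A ^+ l *m _) mxE mulr_sumr mulr_suml.
by apply: eq_bigr => s _; rewrite !mulrA [_^-1 * _]mulrC.
Qed.

Let cvg_mulmxr l (x : R) i j :
  pseries (fun k => (k`!%:R)^-1 * (A ^+ (l + k)) i j) x @ \oo -->
  (mxexp (x *: A) *m A ^+ l) i j.
Proof.
rewrite [X in X @ _ --> _](_ : _ = fun N => \sum_s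
    pseries (fun k => (k`!%:R)^-1 * (A ^+ k) i s) x N * (A ^+ l) s j).
  rewrite mxE; apply: cvg_big => [|s _]; first exact: add_continuous.
  by apply: cvgM; [exact: cvg_mxexp|exact: cvg_cst].
apply/funext => N; rewrite /pseries /series /=.
under [RHS]eq_bigr do rewrite mulr_suml.
rewrite exchange_big; apply: eq_bigr => k _ /=.
rewrite addnC exprD -[_ * A ^+ l]/(_ *m A ^+ l) mxE mulr_sumr mulr_suml.
by apply: eq_bigr => s _; ring.
Qed.

(** Both products are entrywise limits of the same series, with coefficients taken from
    [A ^+ (1 + k)]. *)
Lemma mxexp_comm (x : R) : A *m mxexp (x *: A) = mxexp (x *: A) *m A.
Proof.
apply/matrixP => i j.
by have := cvg_unique _ (@cvg_mulmxl 1 x i j) (@cvg_mulmxr 1 x i j); exact.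
Qed.

Lemma is_derive_mxexp (x : R) i j :
  is_derive x 1 (fun x : R => mxexp (x *: A) i j) ((A *m mxexp (x *: A)) i j).
Proof.
rewrite [X in is_derive _ _ X _](_ : _ = fun x =>
    limn (pseries (fun k => (k`!%:R)^-1 * (A ^+ (0 + k)) i j) x)); last first.
  by apply/funext => y; exact: mxexp_pseries.
rewrite -[A in A *m _]expr1.
have /cvg_lim <-// := @cvg_mulmxl 1 x i j.
rewrite -coef_diffs.
(* Termwise differentiation at [x] asks that the series and its first two formal derivatives, the
   cases [l = 0, 1, 2], converge at a point of larger modulus. *)
apply: (@pseries_snd_diffs _ _ (`|x| + 1)); rewrite ?coef_diffs.
- by apply/cvg_ex; eexists; exact: cvg_mulmxl.
- by apply/cvg_ex; eexists; exact: cvg_mulmxl.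
- by apply/cvg_ex; eexists; exact: cvg_mulmxl.
- by rewrite [ltRHS]ger0_norm ?addr_ge0// ltrDl.
Qed.

Lemma mxexp0 : mxexp (0 *: A) = 1%:M.
Proof.
apply/matrixP => i j; rewrite mxexp_pseries.
apply: cvg_lim => //; apply: cvg_near_cst.
(* The partial sum of length 0 is empty; from length 1 on, only the term [k = 0] survives at the
   point 0. *)
exists 1%N => // -[//|N] _ /=.
rewrite /pseries /series /= big_nat_recl//= big1; last first.
  by move=> k _; rewrite expr0n mulr0.
by rewrite !expr0 fact0 invr1 mul1r mulr1 addr0.
Qed.

End MatrixExponential.

(** * Exponentially decaying functions and a damped scalar equation *)

Section ExponentialDecay.
Variable R : realType.
Implicit Types (f g : R -> R).

(** Constant and rate are existential, so that no rate is tracked through sums and products. The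
    bound at [t = 0] already forces [0 <= K]. *)
Definition exp_decay f :=
  exists K a : R, 0 < a /\ forall t, 0 <= t -> `|f t| <= K * expR (- (a * t)).

Lemma exp_decay0 : exp_decay (fun=> 0).
Proof. by exists 0, 1; split=> // t _; rewrite normr0 mul0r. Qed.

Lemma exp_decayD f g :
  exp_decay f -> exp_decay g -> exp_decay (fun t => f t + g t).
Proof.
move=> [K [a [a0 fK]]] [L [b [b0 gL]]].
exists (K + L), (Num.min a b); split; first by rewrite lt_min a0.
(* Both bounds are brought to the smaller rate. This needs [0 <= M], which is read off from the
   bound itself, the exponential being positive. *)
have weaken h M c t : Num.min a b <= c -> 0 <= t ->
    `|h t| <= M * expR (- (c * t)) -> `|h t| <= M * expR (- (Num.min a b * t)).
  move=> minc t0 hM; apply: (le_trans hM); rewrite ler_wpM2l//.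
    by rewrite -(pmulr_lge0 _ (expR_gt0 (- (c * t)))) (le_trans _ hM).
  by rewrite ler_expR lerN2 ler_wpM2r.
move=> t t0; rewrite mulrDl (le_trans (ler_normD _ _))// lerD//.
  by apply: weaken (fK t t0); rewrite // ge_min lexx.
by apply: weaken (gL t t0); rewrite // ge_min lexx orbT.
Qed.

Lemma exp_decay_sum (I : Type) (r : seq I) (F : I -> R -> R) :
  (forall i, exp_decay (F i)) -> exp_decay (fun t => \sum_(i <- r) F i t).
Proof.
move=> dF; elim: r => [|i r IH].
  by under eq_fun do rewrite big_nil; exact: exp_decay0.
by under eq_fun do rewrite big_cons; exact: exp_decayD.
Qed.

Lemma exp_decayM f g :
  exp_decay f -> exp_decay g -> exp_decay (fun t => f t * g t).
Proof.
move=> [K [a [a0 fK]]] [L [b [b0 gL]]].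
exists (K * L), (a + b); split; first exact: addr_gt0.
move=> t t0; rewrite normrM mulrDl opprD expRD mulrACA.
by rewrite ler_pM ?fK ?gL.
Qed.

Lemma exp_decayZ (c : R) f : exp_decay f -> exp_decay (fun t => c * f t).
Proof.
move=> [K [a [a0 fK]]]; exists (`|c| * K), a; split=> // t t0.
by rewrite normrM -mulrA ler_wpM2l ?fK.
Qed.

(** Energy estimates control squares; taking roots halves the rate. *)
Lemma exp_decay_sqr f : exp_decay (fun t => f t ^+ 2) -> exp_decay f.
Proof.
move=> [K [a [a0 fK]]].
have K0 : 0 <= K.
  by have := fK 0 (lexx _); rewrite mulr0 oppr0 expR0 mulr1; exact: le_trans.
exists (Num.sqrt K), (a / 2); split=> [|t t0]; first by rewrite divr_gt0.
rewrite -(@ler_pXn2r _ 2) ?nnegrE ?mulr_ge0 ?expR_ge0 ?sqrtr_ge0//.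
rewrite -normrX (le_trans (fK t t0))// exprMn sqr_sqrtr// -expRM_natl.
by rewrite (_ : 2 * _ = - (a * t))//; field.
Qed.

Lemma is_derive_expR_lin (c t : R) :
  is_derive t 1 (fun s : R => expR (c * s)) (c * expR (c * t)).
Proof.
have dlin : is_derive t 1 (c \*: id) (c *: 1) by exact: is_deriveZ.
have := is_derive1_comp (is_derive_expR (c * t)) dlin.
by rewrite /GRing.scale/= mulr1 mulrC; exact.
Qed.

(* The equation says z' = (mu + i nu) z + g for z = x + i y and g = gx + i gy.
   With c := - mu > 0 one has (|z|^2)' <= - c |z|^2 + |g|^2 / c, so that
   |z|^2 e^(bt) plus a multiple of e^(-at) is nonincreasing for small b. *)
Lemma exp_decay_ode (mu nu : R) (x y gx gy : R -> R) : mu < 0 ->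
  (forall t : R, is_derive t 1 x (mu * x t - nu * y t + gx t)) ->
  (forall t : R, is_derive t 1 y (nu * x t + mu * y t + gy t)) ->
  exp_decay gx -> exp_decay gy -> exp_decay x /\ exp_decay y.
Proof.
move=> mu0 dx dy dgx dgy.
have [K [a [a0 gK]]] : exp_decay (fun t => gx t ^+ 2 + gy t ^+ 2).
  by under eq_fun do rewrite !expr2; apply: exp_decayD; exact: exp_decayM.
(* The bound [b <= - mu] lets the damping absorb [b |z|^2]; the bound [b <= a / 2] keeps the
   forcing, multiplied by [e^(bt)], below a multiple of [e^(-at/2)]. *)
pose b := Num.min (- mu) (a / 2).
have b0 : 0 < b by rewrite lt_min oppr_gt0 mu0 divr_gt0.
have bmu : b <= - mu by rewrite ge_min lexx.
have ba : b <= a / 2 by rewrite ge_min lexx orbT.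
have K0 : 0 <= K.
  have := gK 0 (lexx _); rewrite mulr0 oppr0 expR0 mulr1; exact: le_trans.
(* With this factor, the derivative of [G e^(-at/2)] is exactly minus the bound on the forcing. *)
pose G := K / (- mu) / (a / 2).
pose w t := (x t ^+ 2 + y t ^+ 2) * expR (b * t) + G * expR (- (a / 2 * t)).
pose w' t := (2 * (x t * (mu * x t - nu * y t + gx t) +
                   y t * (nu * x t + mu * y t + gy t)) +
              b * (x t ^+ 2 + y t ^+ 2)) * expR (b * t)
             - K / (- mu) * expR (- (a / 2 * t)).
have dw (t : R) : is_derive t 1 w (w' t).
  rewrite /w; under [X in is_derive _ _ X _]eq_fun do
    rewrite !expr2 -[- (_ * _)]mulNr.
  apply: (@is_derive_eq _ _ _ _ _ _ _ _ (is_deriveD (is_deriveM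
    (is_deriveD (is_deriveM (dx t) (dx t)) (is_deriveM (dy t) (dy t)))
    (is_derive_expR_lin b t))
    (is_deriveZ G (is_derive_expR_lin (- (a / 2)) t)))).
  rewrite /w' /G /GRing.scale/= !fctE -[- (a / 2 * t)]mulNr; field.
  by rewrite lt_eqF// gt_eqF.
(* Weighted arithmetic-geometric inequality: after multiplication by [- mu], the difference of the
   two sides is a square. *)
have amgm u v : 2 * (u * v) <= - mu * u ^+ 2 + v ^+ 2 / (- mu).
  have mu0' : 0 < - mu by rewrite oppr_gt0.
  rewrite -(ler_pM2l mu0') mulrDr [_ * (v ^+ 2 / _)]mulrC divfK ?gt_eqF//.
  rewrite -subr_ge0 (_ : _ - _ = (- mu * u - v) ^+ 2) ?sqr_ge0//; ring.
have w'0 t : 0 <= t -> w' t <= 0.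
  move=> t0; rewrite /w' subr_le0.
  (* The [nu] terms cancel, being a rotation. Of the damping [2 mu |z|^2], one half pays for the
     cross terms with [g] and the other for [b |z|^2]. *)
  have le_bracket : 2 * (x t * (mu * x t - nu * y t + gx t) +
      y t * (nu * x t + mu * y t + gy t)) + b * (x t ^+ 2 + y t ^+ 2) <=
      K / (- mu) * expR (- (a * t)).
    rewrite (@le_trans _ _ ((gx t ^+ 2 + gy t ^+ 2) / (- mu)))//.
      have := amgm (x t) (gx t); have := amgm (y t) (gy t).
      have : b * (x t ^+ 2 + y t ^+ 2) <= - mu * (x t ^+ 2 + y t ^+ 2).
        by rewrite ler_wpM2r// addr_ge0 ?sqr_ge0.
      by lra.
    rewrite mulrAC ler_wpM2r ?invr_ge0 ?oppr_ge0 ?(ltW mu0)//.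
    by rewrite (le_trans (ler_norm _)) ?gK.
  rewrite (le_trans (ler_wpM2r (expR_ge0 _) le_bracket))// -[leLHS]mulrA -expRD.
  rewrite ler_wpM2l ?divr_ge0 ?oppr_ge0 ?(ltW mu0)// ler_expR.
  have := ler_wpM2r t0 ba; lra.
have w_le t : 0 <= t -> w t <= w 0.
  move=> t0; apply: (@ler0_derive1_nincry _ w 0) => //.
  - move=> s; rewrite in_itv/= andbT => /ltW s0.
    by rewrite derive1E derive_val w'0.
  - by apply: derivable_within_continuous => s _; have [] := dw s.
have decay t : 0 <= t -> x t ^+ 2 + y t ^+ 2 <= w 0 * expR (- (b * t)).
  move=> t0; rewrite expRN ler_pdivlMr ?expR_gt0//.
  rewrite (le_trans _ (w_le t t0))// lerDl mulr_ge0 ?expR_ge0//.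
  by rewrite !divr_ge0// ?oppr_ge0 ltW// divr_gt0.
split; apply: exp_decay_sqr; exists (w 0), b; split=> // t t0.
  rewrite ger0_norm ?sqr_ge0// (le_trans _ (decay t t0))//.
  by rewrite lerDl sqr_ge0.
rewrite ger0_norm ?sqr_ge0// (le_trans _ (decay t t0))//.
by rewrite lerDr sqr_ge0.
Qed.

End ExponentialDecay.

(** * Entrywise calculus of matrix functions *)

Section MatrixCalculus.
Variable R : realType.

Lemma is_derive_mulmx (p q r : nat) (F F' : R -> 'M[R]_(p, q))
    (G G' : R -> 'M[R]_(q, r)) (t : R) :
  (forall i j, is_derive t 1 (fun s => F s i j) (F' t i j)) ->
  (forall i j, is_derive t 1 (fun s => G s i j) (G' t i j)) ->
  forall i j, is_derive t 1 (fun s => (F s *m G s) i j)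
    ((F' t *m G t + F t *m G' t) i j).
Proof.
move=> dF dG i j.
rewrite (_ : (fun s => _) =
    \sum_(k < q) (fun s => F s i k) * (fun s => G s k j)).
  apply: (@is_derive_eq _ _ _ _ _ _ _ _
    (is_derive_sum (fun k => is_deriveM (dF i k) (dG k j)))).
  rewrite !mxE -big_split; apply: eq_bigr => k _.
  by rewrite /GRing.scale/= addrC [G t k j * _]mulrC.
by apply/funext => s; rewrite mxE fct_sumE.
Qed.

Lemma exp_decay_mulmx (p q r : nat) (F : R -> 'M[R]_(p, q))
    (G : R -> 'M[R]_(q, r)) :
  (forall i j, exp_decay (fun t => F t i j)) ->
  (forall i j, exp_decay (fun t => G t i j)) ->
  forall i j, exp_decay (fun t => (F t *m G t) i j).
Proof.
move=> dF dG i j; under eq_fun do rewrite mxE.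
by apply: exp_decay_sum => k; exact: exp_decayM.
Qed.

Lemma exp_decay_mulmxr (p q r : nat) (F : R -> 'M[R]_(p, q))
    (M : 'M[R]_(q, r)) :
  (forall i j, exp_decay (fun t => F t i j)) ->
  forall i j, exp_decay (fun t => (F t *m M) i j).
Proof.
move=> dF i j; under eq_fun do rewrite mxE.
by apply: exp_decay_sum => k; under eq_fun do rewrite mulrC; exact: exp_decayZ.
Qed.

(** [A] is moved past the exponential, so that the derivative is again the exponential times a
    constant matrix. *)
Lemma is_derive_mxexp_mulmx (n p : nat) (A : 'M[R]_n) (M : 'M[R]_(n, p))
    (t : R) i j :
  is_derive t 1 (fun s => (mxexp (s *: A) *m M) i j)
    ((mxexp (t *: A) *m (A *m M)) i j).
Proof.
rewrite (_ : _ *m _ = A *m mxexp (t *: A) *m M + mxexp (t *: A) *m 0).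
  apply: (@is_derive_mulmx _ _ _ _ (fun s => A *m mxexp (s *: A)) _ (fun=> 0)).
    by move=> a b; exact: is_derive_mxexp.
  by move=> a b; rewrite mxE; exact: is_derive_cst.
by rewrite mulmx0 addr0 mxexp_comm mulmxA.
Qed.

End MatrixCalculus.

(** * Stability implies exponential decay *)

Section Stability.
Variable R : realType.

(** Complex roots make the matrices [M] below complex, while [A] and its exponential stay real and
    act on real and imaginary parts separately. *)
Lemma Re_map_mulmx (n p : nat) (A : 'M[R]_n) (M : 'M[R[i]]_(n, p)) :
  map_mx (@complex.Re R) (map_mx (real_complex R) A *m M) =
  A *m map_mx (@complex.Re R) M.
Proof.
apply/matrixP => i j; rewrite !mxE raddf_sum; apply: eq_bigr => k _.
by rewrite !mxE; case: (M k j) => a b /=; rewrite mul0r subr0.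
Qed.

Lemma Im_map_mulmx (n p : nat) (A : 'M[R]_n) (M : 'M[R[i]]_(n, p)) :
  map_mx (@complex.Im R) (map_mx (real_complex R) A *m M) =
  A *m map_mx (@complex.Im R) M.
Proof.
apply/matrixP => i j; rewrite !mxE raddf_sum; apply: eq_bigr => k _.
by rewrite !mxE; case: (M k j) => a b /=; rewrite mul0r addr0.
Qed.

(* The entries z of e^(tA) M satisfy z' = r z + g with g an entry of
   e^(tA) (A - r) M, so the roots can be peeled off one at a time. *)
Lemma exp_decay_annihilated (n : nat) (A : 'M[R]_n.+1) (rs : seq R[i])
    (M : 'M[R[i]]_n.+1) :
  (forall r, r \in rs -> complex.Re r < 0) ->
  horner_mx (map_mx (real_complex R) A) (\prod_(r <- rs) ('X - r%:P)) *m M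
    = 0 ->
  forall i j,
    exp_decay (fun t => (mxexp (t *: A) *m map_mx (@complex.Re R) M) i j) /\
    exp_decay (fun t => (mxexp (t *: A) *m map_mx (@complex.Im R) M) i j).
Proof.
elim: rs M => [|r rs IH] M re_rs.
  rewrite big_nil rmorph1 mul1mx => -> i j.
  by rewrite !map_mx0; split; under eq_fun do rewrite mulmx0 mxE;
    exact: exp_decay0.
pose Ac := map_mx (real_complex R) A.
(* The factor of the root [r] is moved next to [M], so that the induction hypothesis applies to
   [(A - r) M]. *)
rewrite big_cons mulrC rmorphM -[_ * _]/(_ *m _) -mulmxA => M0 i j.
have {IH M0} [|dRe dIm] := IH _ _ M0 i j.
  by move=> s srs; apply: re_rs; rewrite in_cons srs orbT.
move: dRe dIm; rewrite rmorphB/= horner_mx_X horner_mx_C mulmxBl mul_scalar_mx.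
have : complex.Re r < 0 by apply: re_rs; rewrite mem_head.
case: r {re_rs} => mu nu /= mu0 dRe dIm.
have ReE : map_mx (@complex.Re R) (Ac *m M - (mu +i* nu)%C *: M) =
    A *m map_mx (@complex.Re R) M - mu *: map_mx (@complex.Re R) M
    + nu *: map_mx (@complex.Im R) M.
  rewrite -Re_map_mulmx; apply/matrixP => a b; rewrite !mxE.
  by case: (M a b) => u v; case: (\sum_k _) => u' v' /=; ring.
have ImE : map_mx (@complex.Im R) (Ac *m M - (mu +i* nu)%C *: M) =
    A *m map_mx (@complex.Im R) M - mu *: map_mx (@complex.Im R) M
    - nu *: map_mx (@complex.Re R) M.
  rewrite -Im_map_mulmx; apply/matrixP => a b; rewrite !mxE.
  by case: (M a b) => u v; case: (\sum_k _) => u' v' /=; ring.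
apply: (@exp_decay_ode _ mu nu _ _ _ _ mu0 _ _ dRe dIm) => t.
  apply: is_derive_eq; first exact: is_derive_mxexp_mulmx.
  rewrite ReE mulmxDr mulmxBr -!scalemxAr.
  move: (mxexp _ *m (A *m _)) (mxexp _ *m map_mx (@complex.Re R) M)
    (mxexp _ *m map_mx (@complex.Im R) M) => X Y Z.
  by rewrite !mxE; ring.
apply: is_derive_eq; first exact: is_derive_mxexp_mulmx.
rewrite ImE !mulmxBr -!scalemxAr.
move: (mxexp _ *m (A *m _)) (mxexp _ *m map_mx (@complex.Re R) M)
    (mxexp _ *m map_mx (@complex.Im R) M) => X Y Z.
by rewrite !mxE; ring.
Qed.

Lemma exp_decay_mxexp (n : nat) (A : 'M[R]_n) : stable A ->
  forall i j, exp_decay (fun t => mxexp (t *: A) i j).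
Proof.
case: n A => [|n] A stA i j; first by case: i.
pose Ac := map_mx (real_complex R) A.
have [rs def_rs] := closed_field_poly_normal (char_poly Ac).
have re_rs r : r \in rs -> complex.Re r < 0.
  move=> rrs; apply: stA; rewrite eigenvalue_root_char def_rs.
  by rewrite (monicP (char_poly_monic _)) scale1r root_prod_XsubC.
(* The peeling starts from the identity matrix; the characteristic polynomial is monic, hence equal
   to the product of its linear factors. *)
have CH : horner_mx Ac (\prod_(r <- rs) ('X - r%:P)) *m 1%:M = 0.
  rewrite mulmx1 -[RHS](Cayley_Hamilton Ac) def_rs.
  by rewrite (monicP (char_poly_monic _)) scale1r.
have [+ _] := exp_decay_annihilated re_rs CH i j.
rewrite (_ : map_mx _ _ = 1%:M); first by under eq_fun do rewrite mulmx1.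
by apply/matrixP => a b; rewrite !mxE; case: (_ == _).
Qed.

(** A matrix and its transpose have the same characteristic polynomial. This reduces the
    observability half to the reachability half. *)
Lemma stable_trmx (n : nat) (A : 'M[R]_n) : stable A -> stable A^T.
Proof.
move=> stA z; rewrite eigenvalue_root_char => z_root; apply: stA.
rewrite eigenvalue_root_char; move: z_root; rewrite /char_poly -det_tr.
congr (root (\det _) z); apply/matrixP => i j.
by rewrite !mxE eq_sym.
Qed.

End Stability.

(** * Integrals over the half line *)

Section HalfLineIntegral.
Local Open Scope classical_set_scope.
Variable R : realType.
Implicit Types (f F : R -> R).
Notation mu := (@lebesgue_measure R).

Lemma is_derive_continuous f F :
  (forall t : R, is_derive t 1 F (f t)) -> continuous F.
Proof.
move=> dF t; apply: differentiable_continuous.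
by apply/derivable1_diffP; have [] := dF t.
Qed.

Lemma cvgy_exp_decay f : exp_decay f -> f t @[t --> +oo] --> 0.
Proof.
move=> [K [a [a0 fK]]].
have expy : (K * expR (- (a * t))) @[t --> +oo] --> 0.
  rewrite -(mulr0 K); apply: cvgM; first exact: cvg_cst.
  apply: (@cvg_comp _ _ _ (fun t => a * t) (fun u => expR (- u)) _
    (pinfty_nbhs R)); last exact: cvgr_expR.
  exact: gt0_cvgMry.
apply/norm_cvg0P; apply: (squeeze_cvgr _ (cvg_cst 0) expy).
exists 0; split=> // t /ltW t0.
by rewrite normr_ge0 fK.
Qed.

(** Fundamental theorem of calculus for a nonnegative integrand; decay of [F] removes the boundary
    term at infinity. *)
Lemma integral_ge0_exp_decay f F :
  (forall t : R, is_derive t 1 F (f t)) -> continuous f -> exp_decay F ->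
  (forall t, 0 <= t -> 0 <= f t) ->
  (\int[mu]_(t in `[0%R, +oo[) (f t)%:E = (- F 0)%:E)%E.
Proof.
move=> dF cf decF f0.
rewrite (ge0_continuous_FTC2y f0 _ (cvgy_exp_decay decF)).
- by rewrite -EFinB sub0r.
- by apply: continuous_subspaceT.
- by move=> t _; have [] := dF t.
- by apply: cvg_at_right_filter; exact: (is_derive_continuous dF).
- by move=> t _; rewrite derive1E derive_val.
Qed.

Lemma is_derive_exp_primitive (K a t : R) : a != 0 ->
  is_derive t 1 (- (K / a) \*: (fun s : R => expR (- a * s)))
    (K * expR (- a * t)).
Proof.
move=> a0; apply: (is_derive_eq (is_deriveZ _ (is_derive_expR_lin _ _))).
by rewrite /GRing.scale/=; field.
Qed.

Lemma exp_decay_exp (K a : R) : 0 < a ->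
  exp_decay (fun t => K * expR (- a * t)).
Proof.
move=> a0; apply: exp_decayZ; exists 1, a; split=> // t _.
by rewrite mul1r ger0_norm ?expR_ge0// mulNr.
Qed.

Lemma continuous_exp (K a : R) : continuous (fun t : R => K * expR (- a * t)).
Proof.
move=> t; apply: cvgM; first exact: cvg_cst.
exact: (is_derive_continuous (is_derive_expR_lin (- a))).
Qed.

Lemma integrable_ge0_exp_decay f F :
  (forall t : R, is_derive t 1 F (f t)) -> continuous f -> exp_decay F ->
  (forall t, 0 <= t -> 0 <= f t) ->
  mu.-integrable `[0%R, +oo[ (EFin \o f).
Proof.
move=> dF cf decF f0; apply/integrableP; split.
  apply/measurable_EFinP; apply: measurable_funTS.
  exact: continuous_measurable_fun.
apply: (@le_lt_trans _ _ (\int[mu]_(t in `[0%R, +oo[) (f t)%:E)%E).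
  rewrite le_eqVlt; apply/orP; left; apply/eqP.
  apply: eq_integral => t; rewrite inE/= in_itv/= andbT => t0.
  by rewrite ger0_norm ?f0.
by rewrite (integral_ge0_exp_decay dF cf decF f0) ltry.
Qed.

Lemma integrable_exp_decay f : continuous f -> exp_decay f ->
  mu.-integrable `[0%R, +oo[ (EFin \o f).
Proof.
move=> cf [K [a [a0 fK]]].
have inth : mu.-integrable `[0%R, +oo[ (EFin \o (fun t => K * expR (- a * t))).
  apply: integrable_ge0_exp_decay.
  - by move=> t; apply: is_derive_exp_primitive; rewrite gt_eqF.
  - exact: continuous_exp.
  - exact: exp_decay_exp.
  - by move=> t t0; rewrite mulNr (le_trans _ (fK t t0)).
apply: le_integrable inth => //.
- apply/measurable_EFinP; apply: measurable_funTS.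
  exact: continuous_measurable_fun.
- move=> t /=; rewrite in_itv/= andbT => t0.
  by rewrite lee_fin [leRHS]ger0_norm mulNr ?fK// (le_trans _ (fK t t0)).
Qed.

Lemma Rintegral_exp_decay f F :
  (forall t : R, is_derive t 1 F (f t)) -> continuous f ->
  exp_decay F -> exp_decay f ->
  \int[mu]_(t in `[0, +oo[) f t = - F 0.
Proof.
move=> dF cf decF decf; have [K [a [a0 fK]]] := decf.
(* To drop the sign condition, an exponential [h] dominating [|f|] is added and subtracted: [f + h]
   and [h] are nonnegative and have decaying primitives. *)
pose h t := K * expR (- a * t); pose H t := - (K / a) * expR (- a * t).
have dh (t : R) : is_derive t 1 H (h t).
  by apply: is_derive_exp_primitive; rewrite gt_eqF.
have ch : continuous h by exact: continuous_exp.
have dech : exp_decay h by exact: exp_decay_exp.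
have decH : exp_decay H by exact: exp_decay_exp.
have hf t : 0 <= t -> `|f t| <= h t by move=> t0; rewrite /h mulNr fK.
have h0 t : 0 <= t -> 0 <= h t by move=> t0; rewrite (le_trans _ (hf t t0)).
have cfh : continuous (fun t => f t + h t).
  by move=> t; apply: cvgD; [exact: cf|exact: ch].
have fh0 t : 0 <= t -> 0 <= f t + h t.
  by move=> /hf; rewrite ler_norml => /andP[+ _]; rewrite -subr_ge0 opprK.
have dfh (t : R) : is_derive t 1 (F + H) (f t + h t) by exact: is_deriveD.
have decFH : exp_decay (F + H) by exact: exp_decayD.
have -> : \int[mu]_(t in `[0, +oo[) f t =
    \int[mu]_(t in `[0, +oo[) ((f t + h t) - h t).
  by congr Rintegral; apply/funext => t; rewrite addrK.
rewrite RintegralB//.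
- rewrite /Rintegral (integral_ge0_exp_decay dfh cfh decFH fh0).
  by rewrite (integral_ge0_exp_decay dh ch decH h0)/= !fctE; ring.
- exact: (integrable_ge0_exp_decay dfh).
- exact: (integrable_ge0_exp_decay dh).
Qed.

End HalfLineIntegral.

(** * Matrix integrals and linear maps *)

Section MatrixIntegral.
Local Open Scope classical_set_scope.
Variable R : realType.
Notation mu := (@lebesgue_measure R).

(** The two conclusions share one induction, since additivity of the integral uses integrability of
    the remaining sum. *)
Lemma Rintegral_sum (I : Type) (r : seq I) (f : I -> R -> R) :
  (forall i, mu.-integrable `[0%R, +oo[ (EFin \o f i)) ->
  mu.-integrable `[0%R, +oo[ (EFin \o (fun t => \sum_(i <- r) f i t)) /\
  \int[mu]_(t in `[0%R, +oo[) (\sum_(i <- r) f i t) =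
    \sum_(i <- r) \int[mu]_(t in `[0%R, +oo[) f i t.
Proof.
move=> intf; elim: r => [|i r [intr IH]].
  rewrite big_nil (_ : (fun t => _) = cst 0); last first.
    by apply/funext => t; rewrite big_nil.
  split; first exact: integrable0.
  by rewrite /Rintegral integral0.
rewrite big_cons -IH (_ : (fun t => _) = fun t => f i t + \sum_(j <- r) f j t).
  split; last exact: RintegralD.
  rewrite (_ : EFin \o _ =
    (fun t => (f i t)%:E + (\sum_(j <- r) f j t)%:E)%E) //.
  by apply: (integrableD _ (intf i) intr).
by apply/funext => t; rewrite big_cons.
Qed.

(** Each entry of [phi X] is a fixed finite linear combination of the entries of [X], with
    coefficients given by the elementary matrices. *)
Lemma mxint1_linear (p q r s : nat) (phi : 'M[R]_(p, q) -> 'M[R]_(r, s))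
    (F : R -> 'M[R]_(p, q)) :
  linear phi -> mxcvg1 F ->
  mxcvg1 (fun t => phi (F t)) /\ mxint1 (fun t => phi (F t)) = phi (mxint1 F).
Proof.
move=> lin_phi cvgF.
pose phiL : {linear 'M[R]_(p, q) -> 'M[R]_(r, s)} :=
  HB.pack phi (GRing.isLinear.Build _ _ _ _ phi lin_phi).
have phiE X i j : phi X i j =
    \sum_(k : 'I_p * 'I_q) phi (delta_mx k.1 k.2) i j * X k.1 k.2.
  rewrite [X in phi X]matrix_sum_delta pair_bigA/= -[phi]/(phiL : _ -> _).
  rewrite linear_sum summxE; apply: eq_bigr => k _.
  by rewrite linearZ mxE mulrC.
have int_phi i j (k : 'I_p * 'I_q) : mu.-integrable `[0%R, +oo[
    (EFin \o (fun t => phi (delta_mx k.1 k.2) i j * F t k.1 k.2)).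
  by apply: (integrableZl _ _ (cvgF k.1 k.2)).
split=> [i j|].
  have [+ _] := Rintegral_sum (index_enum _) (int_phi i j).
  by congr (_.-integrable _ _); apply/funext => t /=; rewrite phiE.
apply/matrixP => i j; rewrite mxE phiE.
under eq_Rintegral do rewrite phiE.
have [_ ->] := Rintegral_sum (index_enum _) (int_phi i j).
apply: eq_bigr => k _; rewrite mxE RintegralZl//; exact: cvgF.
Qed.

Lemma linear_mulmx2 (p q r s : nat) (U : 'M[R]_(r, p)) (V : 'M[R]_(q, s)) :
  linear (fun X => U *m X *m V).
Proof.
by move=> c X Y; rewrite mulmxDr mulmxDl -scalemxAr -scalemxAl.
Qed.

Lemma linear_tensl (p q r s : nat) (Y : 'M[R]_(r, s)) :
  linear (fun X : 'M[R]_(p, q) => X *t Y).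
Proof. by move=> c X Z; apply/matrixP => i j; rewrite !mxE; ring. Qed.

Lemma linear_tensr (p q r s : nat) (X : 'M[R]_(p, q)) :
  linear (fun Y : 'M[R]_(r, s) => X *t Y).
Proof. by move=> c Y Z; apply/matrixP => i j; rewrite !mxE; ring. Qed.

End MatrixIntegral.

(** * The Lyapunov integral and its equation *)

Section LyapunovIntegral.
Variables (R : realType) (n : nat) (A : 'M[R]_n).
Hypothesis stA : stable A.

(** This is the solution of [X' = A X + X A^T] with [X(0) = S]. *)
Definition lyapunov_integrand (S : 'M[R]_n) (t : R) :=
  mxexp (t *: A) *m S *m (mxexp (t *: A))^T.

Definition lyapunov_integral S := mxint1 (lyapunov_integrand S).

Lemma exp_decay_lyapunov_integrand S i j :
  exp_decay (fun t => lyapunov_integrand S t i j).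
Proof.
apply: exp_decay_mulmx => a b.
  by apply: exp_decay_mulmxr => ? ?; exact: exp_decay_mxexp.
by under eq_fun do rewrite mxE; exact: exp_decay_mxexp.
Qed.

Lemma is_derive_lyapunov_integrand S (t : R) i j :
  is_derive t 1 (fun t => lyapunov_integrand S t i j)
    (lyapunov_integrand (A *m S + S *m A^T) t i j).
Proof.
apply: (@is_derive_eq _ _ _ _ _ _ _ _ (is_derive_mulmx
  (F := fun t => mxexp (t *: A) *m S) (G := fun t => (mxexp (t *: A))^T)
  (F' := fun t => mxexp (t *: A) *m (A *m S))
  (G' := fun t => (A *m mxexp (t *: A))^T) _ _ i j)).
- by move=> a b; exact: is_derive_mxexp_mulmx.
- move=> a b; rewrite mxE [X in is_derive _ _ X _](_ : _ =
    fun s => mxexp (s *: A) b a); last by apply/funext => s; rewrite mxE.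
  exact: is_derive_mxexp.
- rewrite /lyapunov_integrand mxexp_comm trmx_mul.
  by rewrite mulmxDr mulmxDl !mulmxA.
Qed.

Lemma mxcvg1_lyapunov_integrand S : mxcvg1 (lyapunov_integrand S).
Proof.
move=> i j; apply: integrable_exp_decay.
  exact: (is_derive_continuous (fun t => is_derive_lyapunov_integrand S t i j)).
exact: exp_decay_lyapunov_integrand.
Qed.

Lemma lyapunov_integral_sylvester S :
  lyapunov_integral (A *m S + S *m A^T) = - S.
Proof.
apply/matrixP => i j; rewrite mxE.
rewrite (Rintegral_exp_decay
  (fun t => is_derive_lyapunov_integrand S t i j)).
- by rewrite /lyapunov_integrand mxexp0 trmx1 mul1mx mulmx1 mxE.
- exact: (is_derive_continuous (fun t => is_derive_lyapunov_integrand _ t i j)).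
- exact: exp_decay_lyapunov_integrand.
- exact: exp_decay_lyapunov_integrand.
Qed.

Lemma sylvester_lyapunov_integral S :
  A *m lyapunov_integral S + lyapunov_integral S *m A^T = - S.
Proof.
rewrite -lyapunov_integral_sylvester.
have lin : linear (fun X : 'M[R]_n => A *m X + X *m A^T).
  move=> c X Y; rewrite mulmxDr mulmxDl -scalemxAr -scalemxAl scalerDr.
  by rewrite addrACA.
have [_ <-] := mxint1_linear lin (mxcvg1_lyapunov_integrand S).
congr mxint1; apply/funext => t; rewrite /lyapunov_integrand.
(* Under the integral, [A] passes through the exponential and [A^T] through its transpose, so both
   act on [S]. *)
rewrite mulmxDr mulmxDl !mulmxA -mxexp_comm -!mulmxA -trmx_mul mxexp_comm.
by rewrite trmx_mul.
Qed.

Lemma lyapunov_equationP S X :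
  A *m X + X *m A^T + S = 0 <-> X = lyapunov_integral S.
Proof.
split=> [/eqP|->]; last by rewrite sylvester_lyapunov_integral addNr.
rewrite addr_eq0 => /eqP eqS; apply: oppr_inj.
(* Uniqueness: writing [L] for the integral, [- X = L(A X + X A^T) = L(- S) = - L(S)]. *)
rewrite -lyapunov_integral_sylvester eqS.
have linN : linear (fun Z : 'M[R]_n => - Z).
  by move=> c Y Z; rewrite opprD scalerN.
have [_ <-] := mxint1_linear linN (mxcvg1_lyapunov_integrand S).
congr mxint1; apply/funext => t.
by rewrite /lyapunov_integrand mulmxN mulNmx.
Qed.

(** For fixed [t2] the integrand is linear in [X t1], so the inner integral passes inside [phi] and
    a single Lyapunov integral in [t2] remains. *)
Lemma lyapunov_integral2 (p q : nat) (phi : 'M[R]_(p, q) -> 'M[R]_n)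
    (X : R -> 'M[R]_(p, q)) : linear phi -> mxcvg1 X ->
  let F t1 t2 := lyapunov_integrand (phi (X t1)) t2 in
  mxcvg2 F /\ mxint2 F = lyapunov_integral (phi (mxint1 X)).
Proof.
move=> lin_phi cvgX F.
have lin t2 : linear (fun Z => lyapunov_integrand (phi Z) t2).
  by move=> c Z W; rewrite /lyapunov_integrand lin_phi linear_mulmx2.
have inner t2 := mxint1_linear (lin t2) cvgX.
have innerE : (fun t2 => mxint1 (F^~ t2)) =
    lyapunov_integrand (phi (mxint1 X)).
  by apply/funext => t2; have [_] := inner t2.
split; last by rewrite /mxint2 innerE.
split=> [t2 _|]; first by have [] := inner t2.
by rewrite innerE; exact: mxcvg1_lyapunov_integrand.
Qed.

(** The Kronecker product is bilinear: [t1] is integrated with [Y t2] fixed, then [t2] with the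
    integral of [X] as left factor. *)
Lemma lyapunov_integral3 (p q : nat) (H : 'M[R]_(n, p * q))
    (X : R -> 'M[R]_p) (Y : R -> 'M[R]_q) : mxcvg1 X -> mxcvg1 Y ->
  let F t1 t2 t3 := lyapunov_integrand (H *m (X t1 *t Y t2) *m H^T) t3 in
  mxcvg3 F /\
  mxint3 F = lyapunov_integral (H *m (mxint1 X *t mxint1 Y) *m H^T).
Proof.
move=> cvgX cvgY F.
have linX t2 t3 :
    linear (fun Z => lyapunov_integrand (H *m (Z *t Y t2) *m H^T) t3).
  by move=> c Z W; rewrite /lyapunov_integrand linear_tensl !linear_mulmx2.
have linY Z t3 :
    linear (fun W => lyapunov_integrand (H *m (Z *t W) *m H^T) t3).
  by move=> c W W'; rewrite /lyapunov_integrand linear_tensr !linear_mulmx2.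
have int1 t2 t3 := mxint1_linear (linX t2 t3) cvgX.
have int2 t3 := mxint1_linear (linY (mxint1 X) t3) cvgY.
have int1E t3 : (fun t2 => mxint1 (fun t1 => F t1 t2 t3)) =
    fun t2 => lyapunov_integrand (H *m (mxint1 X *t Y t2) *m H^T) t3.
  by apply/funext => t2; have [_] := int1 t2 t3.
have int2E : (fun t3 => mxint2 (fun t1 t2 => F t1 t2 t3)) =
    lyapunov_integrand (H *m (mxint1 X *t mxint1 Y) *m H^T).
  by apply/funext => t3; rewrite /mxint2 int1E; have [_] := int2 t3.
split; last by rewrite /mxint3 int2E.
split=> [t3 _|]; last by rewrite int2E; exact: mxcvg1_lyapunov_integrand.
split=> [t2 _|]; first by have [] := int1 t2 t3.
by rewrite int1E; have [] := int2 t3.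
Qed.

End LyapunovIntegral.

(** * Block computation for the bilinear terms *)

Section HorizontalConcatenation.
Variable R : realType.

Lemma sum_mxtens_index (m n : nat) (F : 'I_(m * n) -> R) :
  \sum_l F l = \sum_k \sum_j F (mxtens_index (k, j)).
Proof.
rewrite pair_bigA (reindex (@mxtens_index m n)); first by apply: eq_bigr => -[].
by apply: onW_bij; exists (@mxtens_unindex m n);
  [exact: mxtens_indexK | exact: mxtens_unindexK].
Qed.

Lemma hcat_tens1 (n m : nat) (N : 'I_m -> 'M[R]_n) (X : 'M[R]_n) :
  hcat N *m (1%:M *t X) *m (hcat N)^T = \sum_k N k *m X *m (N k)^T.
Proof.
(* [1%:M *t X] is block diagonal, so it multiplies each block of the concatenation by [X]; the
   product with the transpose then sums over blocks. *)
have -> : hcat N *m (1%:M *t X) = hcat (fun k => N k *m X).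
  apply/matrixP => i l; case: (mxtens_indexP l) => k j.
  rewrite !mxE mxtens_indexK/= sum_mxtens_index (bigD1 k)//=.
  rewrite [X in _ + X]big1 ?addr0 => [|k' neq].
    apply: eq_bigr => j' _.
    by rewrite !mxE !mxtens_indexK/= eqxx mul1r.
  rewrite big1// => j' _.
  by rewrite !mxE !mxtens_indexK/= (negbTE neq) mul0r mulr0.
apply/matrixP => i l; rewrite mxE summxE sum_mxtens_index.
apply: eq_bigr => k _; rewrite mxE; apply: eq_bigr => j _.
by rewrite !mxE !mxtens_indexK.
Qed.

End HorizontalConcatenation.

(** * The Gramians as Lyapunov integrals *)

Lemma mulTM (R : realType) (p q r : nat) (X : 'M[R]_(p, q)) (Y : 'M[R]_(q, r)) :
  mulT (X *m Y) = X *m mulT Y *m X^T.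
Proof. by rewrite /mulT trmx_mul !mulmxA. Qed.

Lemma mulT_tens (R : realType) (p q r s : nat) (X : 'M[R]_(p, q))
    (Y : 'M[R]_(r, s)) :
  mulT (X *t Y) = mulT X *t mulT Y.
Proof. by rewrite /mulT trmx_tens tensmx_mul. Qed.

Lemma mulT_scalar1 (R : realType) (m : nat) : mulT (1%:M : 'M[R]_m) = 1%:M.
Proof. by rewrite /mulT trmx1 mulmx1. Qed.

Lemma Phat1_lyapunov (R : realType) (n m : nat) (A : 'M[R]_n)
    (B : 'M[R]_(n, m)) : stable A ->
  mxcvg1 (fun t => mulT (Ptilde1 A B t)) /\
  Phat1 A B = lyapunov_integral A (mulT B).
Proof.
move=> stA; rewrite /Phat1 (_ : (fun t => _) = lyapunov_integrand A (mulT B)).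
  by split=> //; exact: mxcvg1_lyapunov_integrand.
by apply/funext => t; rewrite mulTM.
Qed.

(** The width [q] of [B] is kept apart from the number [m] of matrices [N k], so that [C^T] can take
    the place of [B]. *)
Lemma Phat2_lyapunov (R : realType) (n m q : nat) (A : 'M[R]_n)
    (N : 'I_m -> 'M[R]_n) (B : 'M[R]_(n, q)) : stable A ->
  let F t1 t2 :=
    mulT (mxexp (t2 *: A) *m hcat N *m (1%:M *t Ptilde1 A B t1)) in
  mxcvg2 F /\
  mxint2 F = lyapunov_integral A (\sum_k N k *m Phat1 A B *m (N k)^T).
Proof.
move=> stA; have [cvgP _] := Phat1_lyapunov B stA.
have lin : linear (fun X => hcat N *m (1%:M *t X) *m (hcat N)^T).
  by move=> c X Y; rewrite linear_tensr linear_mulmx2.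
rewrite -hcat_tens1 /=.
rewrite (_ : (fun t1 t2 => _) = fun t1 t2 => lyapunov_integrand A
  (hcat N *m (1%:M *t mulT (Ptilde1 A B t1)) *m (hcat N)^T) t2).
  have := lyapunov_integral2 stA lin cvgP; exact.
apply/funext => t1; apply/funext => t2.
by rewrite -mulmxA mulTM mulTM mulT_tens mulT_scalar1.
Qed.

(* Stated with three state matrices so as to cover both Ptilde3 and Qtilde3. *)
Lemma Phat3_lyapunov (R : realType) (n p q r s : nat) (A : 'M[R]_n)
    (A1 : 'M[R]_p) (A2 : 'M[R]_q) (H : 'M[R]_(n, p * q))
    (B1 : 'M[R]_(p, r)) (B2 : 'M[R]_(q, s)) :
  stable A -> stable A1 -> stable A2 ->
  let F t1 t2 t3 :=
    mulT (mxexp (t3 *: A) *m H *m (Ptilde1 A1 B1 t1 *t Ptilde1 A2 B2 t2)) in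
  mxcvg3 F /\
  mxint3 F = lyapunov_integral A (H *m (Phat1 A1 B1 *t Phat1 A2 B2) *m H^T).
Proof.
move=> stA stA1 stA2 /=.
have [cvg1 _] := Phat1_lyapunov B1 stA1.
have [cvg2 _] := Phat1_lyapunov B2 stA2.
rewrite (_ : (fun t1 t2 t3 => _) = fun t1 t2 t3 => lyapunov_integrand A
  (H *m (mulT (Ptilde1 A1 B1 t1) *t mulT (Ptilde1 A2 B2 t2)) *m H^T) t3).
  by have := lyapunov_integral3 stA H cvg1 cvg2; exact.
apply/funext => t1; apply/funext => t2; apply/funext => t3.
by rewrite -mulmxA mulTM mulTM mulT_tens.
Qed.

Theorem corollary3p4 (R : realType) (n m p : nat)
    (A : 'M[R]_n) (N : 'I_m -> 'M[R]_n) (H : 'M[R]_(n, n * n))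
    (B : 'M[R]_(n, m)) (C : 'M[R]_(p, n))
    (stableA : stable A) (symH : hessian_symmetric H) :
  let P := truncated_reachability_gramian A N H B in
  let Q := truncated_observability_gramian A N H B C in
  let P1 := Phat1 A B in
  let Q1 := Qhat1 A C in
  (truncated_reachability_gramian_exists A N H B /\
   truncated_observability_gramian_exists A N H B C) /\
  (A *m P + P *m A^T + H *m (P1 *t P1) *m H^T
     + \sum_(k < m) N k *m P1 *m (N k)^T + B *m B^T = 0 /\
   A^T *m Q + Q *m A + mode2 H *m (P1 *t Q1) *m (mode2 H)^T
     + \sum_(k < m) (N k)^T *m Q1 *m N k + C^T *m C = 0) /\
  ((forall X : 'M[R]_n, A *m X + X *m A^T + B *m B^T = 0 <-> X = P1) /\
   (forall Y : 'M[R]_n, A^T *m Y + Y *m A + C^T *m C = 0 <-> Y = Q1)).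
Proof.
move=> P Q P1 Q1; have stAT := stable_trmx stableA.
have [cvgP1 P1E] := Phat1_lyapunov B stableA.
have [cvgP2 P2E] := Phat2_lyapunov N B stableA.
have [cvgP3 P3E] := Phat3_lyapunov H B B stableA stableA stableA.
(* By unfolding, [Qtilde1 A C] is [Ptilde1 A^T C^T], so the observability integrals are instances of
   the same lemmas. *)
have [cvgQ1 Q1E] := Phat1_lyapunov C^T stAT.
have [cvgQ2 Q2E] := Phat2_lyapunov (fun k => (N k)^T) C^T stAT.
have [cvgQ3 Q3E] := Phat3_lyapunov (mode2 H) B C^T stAT stableA stAT.
split.
  split; split.
  - exact: cvgP1.
  - exact: cvgP2.
  - exact: cvgP3.
  - exact: cvgQ1.
  - exact: cvgQ2.
  - exact: cvgQ3.
have eqP := sylvester_lyapunov_integral stableA.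
have eqQ := sylvester_lyapunov_integral stAT.
rewrite trmxK in eqQ.
have PE : P = lyapunov_integral A (mulT B) +
    lyapunov_integral A (\sum_(k < m) N k *m P1 *m (N k)^T) +
    lyapunov_integral A (H *m (P1 *t P1) *m H^T).
  by congr (_ + _ + _); [exact: P1E|exact: P2E|exact: P3E].
have QE : Q = lyapunov_integral A^T (mulT C^T) +
    lyapunov_integral A^T (\sum_(k < m) (N k)^T *m Q1 *m N k) +
    lyapunov_integral A^T (mode2 H *m (P1 *t Q1) *m (mode2 H)^T).
  congr (_ + _ + _); [exact: Q1E| |exact: Q3E].
  by under eq_bigr do rewrite -[N _ in X in _ *m X]trmxK; exact: Q2E.
have mulTC : C^T *m C = mulT C^T by rewrite /mulT trmxK.
split; [split|split=> X].
(* Regrouping pairs each [A *m L(S)] with its own [L(S) *m A^T]; the resulting [- S] cancel the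
   three remaining terms, innermost first. *)
- rewrite PE !mulmxDr !mulmxDl addrACA [X in X + _ + _ + _ + _]addrACA !eqP.
  by rewrite !subrK addNr.
- rewrite QE !mulmxDr !mulmxDl addrACA [X in X + _ + _ + _ + _]addrACA !eqQ.
  by rewrite !subrK mulTC addNr.
- by have := lyapunov_equationP stableA (mulT B) X; rewrite -P1E; exact.
- have := lyapunov_equationP stAT (mulT C^T) X.
  by rewrite -Q1E trmxK -mulTC; exact.
Qed.
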